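(* Let $L \ge 0$, $E \in \Psi_L$, and let $R \in \Gamma_0$ have locally bounded subgradients. Suppose that the surrogate function $F$ is a KL function. Suppose that, for some $\rho_1 > 0$, the stepsizes satisfy $0 < \tau^k \leq \frac{2}{L + 2\rho_1}$ for all $k$, and that $\inf_k \tau^k > 0$. Let $\{(u^k,q^k)\}_{k\ge0}$ be generated by the specialised linearised Bregman iteration from $u^0$ and $q^0 \in \partial R(u^0)$. Then the sequence $\{u^k\}_{k}$ has finite length, i.e. $$\sum_{k=0}^\infty \|u^{k+1}-u^k\| < \infty .$$
   Context: $\|\cdot\|$ is the Euclidean norm. $\Gamma_0$ is the set of proper, lower semi-continuous, convex functions $\mathbb{R}^n \to \mathbb{R}\cup\{\infty\}$. $\Psi_L$ is the set of continuously differentiable functions $E:\mathbb{R}^n\to\mathbb{R}$ (not necessarily convex) whose gradient is Lipschitz continuous with constant $L$, that have bounded level sets, and that are bounded from below. $\partial R$ is the convex subdifferential and $R^\ast(p) := \sup_{u}\{\langle u,p\rangle - R(u)\}$ is the convex conjugate. $R$ has locally bounded subgradients if for every compact set $U\subset\mathbb{R}^n$ there exists a constant $C\in(0,\infty)$ such that for all $v\in U$ and all $q\in\partial R(v)$ we have $\|q\|\le C$. Specialised linearised Bregman iteration: given positive stepsizes $\{\tau^k\}_{k\ge 0}$, $u^0$ and $q^0 \in \partial R(u^0)$, for $k = 0,1,\dots$ set $$u^{k+1} = (I+\tau^k \partial R)^{-1}\left(u^k + \tau^k(q^k - \nabla E(u^k))\right), \qquad q^{k+1} = q^k - \frac{1}{\tau^k}\left(u^{k+1}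 - u^k + \tau^k \nabla E(u^k)\right),$$ where $(I+\tau\partial R)^{-1}(f) := \arg\min_{u}\{\frac12\|u-f\|^2 + \tau R(u)\}$. One has $q^{k}\in\partial R(u^{k})$ for all $k$. Surrogate function: $F:\mathbb{R}^n\times\mathbb{R}^n \to \mathbb{R}\cup\{\infty\}$, $F(x,y) := E(x) + R(x) + R^\ast(y) - \langle x,y\rangle$, with subdifferential $$\partial F(x,y) = \left\{ \begin{pmatrix} \nabla E(x) + z_1 - y \\ z_2 - x\end{pmatrix} : z_1 \in \partial R(x),\ z_2 \in \partial R^\ast(y)\right\}.$$ KL property: for a set $\Omega$, $\operatorname{dist}(w,\Omega):=\inf\{\|v-w\| : v\in\Omega\}$ if $\Omega\ne\emptyset$ and $\infty$ otherwise. A function $J$ on $\mathbb{R}^N$ has the Kurdyka-Łojasiewicz (KL) property at $\overline{w}\in\operatorname{dom}(\partial J):=\{w : \partial J(w)\neq\emptyset\}$ if there exist $\eta\in(0,\infty]$, a neighbourhood $\Theta$ of $\overline{w}$ and a concave function $\varphi:[0,\eta)\to[0,\infty)$ that is continuous at $0$ with $\varphi(0)=0$, $\varphi\in C^1((0,\eta))$ and $\varphi'(s)>0$ for all $s\in(0,\eta)$, such that for all $w\in\Theta$ with $J(\overline{w})<J(w)<J(\overline{w})+\eta$, $$\varphi'\left(J(w)-J(\overline{w})\right)\operatorname{dist}(0,\partial J(w))\ge 1 .$$ $J$ is a KL function if it has the KL property at each point of $\operatorname{dom}(\partial J)$. Here this is applied to $J=F$ on $\mathbb{R}^n\times\mathbb{R}^n$.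 *)

(* Defs.v *)
From HB Require Import structures.
From mathcomp Require Import all_boot all_order all_algebra.
From mathcomp Require Import all_classical all_reals all_analysis.

Set Implicit Arguments.
Unset Strict Implicit.
Unset Printing Implicit Defensive.

Import Order.TTheory GRing.Theory Num.Theory.
Import numFieldNormedType.Exports.

Local Open Scope classical_set_scope.
Local Open Scope ring_scope.
Local Open Scope ereal_scope.

(* The library norm `|_| on 'rV[R]_n is the sup norm, so the Euclidean norm is
   defined here; the library topology on 'rV[R]_n is the usual one. *)
Definition dotv (R : realType) (n : nat) (u v : 'rV[R]_n) : R :=
  (\sum_(i < n) u ord0 i * v ord0 i)%R.

Definition enorm (R : realType) (n : nat) (u : 'rV[R]_n) : R :=
  Num.sqrt (dotv u u).

Definition gradient (R : realType) (n : nat) (E : 'rV[R]_n -> R)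
    (x : 'rV[R]_n) : 'rV[R]_n :=
  (\row_(i < n) 'D_(delta_mx ord0 i) E x)%R.

Definition Psi (R : realType) (n : nat) (L : R) (E : 'rV[R]_n -> R) : Prop :=
  [/\ (forall x, differentiable E x) /\ continuous (gradient E),
      forall x y,
        (enorm (gradient E x - gradient E y) <= L * enorm (x - y))%R,
      forall a : R, bounded_set [set x | (E x <= a)%R]
    & has_lbound (range E)].

(* Functions into R U {+oo} are functions into \bar R that avoid -oo. *)
Definition proper_fun (R : realType) (T : Type) (f : T -> \bar R) : Prop :=
  (forall x, -oo < f x) /\ (exists x, f x < +oo).

Definition econvex (R : realType) (n : nat) (f : 'rV[R]_n -> \bar R) : Prop :=
  forall (x y : 'rV[R]_n) (t : R), (0 <= t <= 1)%R ->
    f (t *: x + (1 - t) *: y)%R <= t%:E * f x + (1 - t)%:E * f y.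

Definition Gamma0 (R : realType) (n : nat) (f : 'rV[R]_n -> \bar R) : Prop :=
  [/\ proper_fun f, lower_semicontinuous f & econvex f].

Definition subdiff (R : realType) (n : nat) (f : 'rV[R]_n -> \bar R)
    (u : 'rV[R]_n) : set 'rV[R]_n :=
  [set p | forall v, f u + (dotv p (v - u)%R)%:E <= f v].

Definition conjugate (R : realType) (n : nat) (f : 'rV[R]_n -> \bar R)
    (p : 'rV[R]_n) : \bar R :=
  ereal_sup (range (fun u => (dotv u p)%:E - f u)).

Definition locally_bounded_subgradients (R : realType) (n : nat)
    (f : 'rV[R]_n -> \bar R) : Prop :=
  forall U : set 'rV[R]_n, compact U ->
    exists C : R, (0 < C)%R /\
      forall v q, U v -> subdiff f v q -> (enorm q <= C)%R.

Definition argmin (R : realType) (T : Type) (f : T -> \bar R) : set T :=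
  [set u | forall v, f u <= f v].

(* For f in Gamma0 and t > 0 this set is a singleton, whose element is the
   value of the resolvent (I + t df)^-1 at g. *)
Definition resolvent (R : realType) (n : nat) (t : R) (f : 'rV[R]_n -> \bar R)
    (g : 'rV[R]_n) : set 'rV[R]_n :=
  argmin (fun u => (2^-1 * enorm (u - g) ^+ 2)%:E + t%:E * f u).

Definition linearised_bregman (R : realType) (n : nat) (E : 'rV[R]_n -> R)
    (f : 'rV[R]_n -> \bar R) (tau : nat -> R) (u q : nat -> 'rV[R]_n) : Prop :=
  subdiff f (u 0%N) (q 0%N) /\
  forall k : nat,
    resolvent (tau k) f (u k + tau k *: (q k - gradient E (u k)))%R (u k.+1) /\
    q k.+1 = (q k -
      (tau k)^-1 *: (u k.+1 - u k + tau k *: gradient E (u k)))%R.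

(* R^n x R^n is identified with 'rV_(n + n), a pair (x, y) being row_mx x y, so
   that enorm is the Euclidean norm of the product space. *)
Definition surrogate (R : realType) (n : nat) (E : 'rV[R]_n -> R)
    (f : 'rV[R]_n -> \bar R) (w : 'rV[R]_(n + n)) : \bar R :=
  let x := lsubmx w in let y := rsubmx w in
  (E x)%:E + f x + conjugate f y - (dotv x y)%:E.

Definition subdiff_surrogate (R : realType) (n : nat) (E : 'rV[R]_n -> R)
    (f : 'rV[R]_n -> \bar R) (w : 'rV[R]_(n + n)) : set 'rV[R]_(n + n) :=
  let x := lsubmx w in let y := rsubmx w in
  [set row_mx (gradient E x + z.1 - y)%R (z.2 - x)%R
     | z in subdiff f x `*` subdiff (conjugate f) y].

(* ereal_inf set0 = +oo, as required when A is empty. *)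
Definition dist_set (R : realType) (N : nat) (w : 'rV[R]_N) (A : set 'rV[R]_N) :
    \bar R :=
  ereal_inf [set (enorm (v - w))%:E | v in A].

(* phi : [0, eta) -> [0, oo) is represented by a total function whose values
   outside [0, eta) are irrelevant. *)
Definition desingularising (R : realType) (eta : \bar R) (phi : R -> R) : Prop :=
  [/\ (forall s : R, (0 <= s)%R -> s%:E < eta -> (0 <= phi s)%R)
      /\ phi 0%R = 0%R,
      convex_function [set s : R^o | (0 <= s)%R /\ s%:E < eta]
        (fun s => - phi s)%R,
      phi s @[s --> 0%R^'+] --> phi 0%R,
      forall s : R, (0 < s)%R -> s%:E < eta ->
        derivable phi s 1%R /\ {for s, continuous (derive1 phi)}
    & forall s : R, (0 < s)%R -> s%:E < eta -> (0 < derive1 phi s)%R].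

(* dJ stands for the subdifferential of J. *)
Definition KL_at (R : realType) (N : nat) (J : 'rV[R]_N -> \bar R)
    (dJ : 'rV[R]_N -> set 'rV[R]_N) (wbar : 'rV[R]_N) : Prop :=
  exists (eta : \bar R) (Theta : set 'rV[R]_N) (phi : R -> R),
    [/\ 0 < eta, nbhs wbar Theta, desingularising eta phi
      & forall w, Theta w -> J wbar < J w -> J w < J wbar + eta ->
          1 <= (derive1 phi (fine (J w - J wbar)))%:E * dist_set 0%R (dJ w)].

Definition KL_function (R : realType) (N : nat) (J : 'rV[R]_N -> \bar R)
    (dJ : 'rV[R]_N -> set 'rV[R]_N) : Prop :=
  forall wbar, dJ wbar !=set0 -> KL_at J dJ wbar.

(* Main.v *)
(* With F the surrogate function, s_k := (u_{k+1}, q_k) and E* := lim E(u_k), the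
   descent lemma and the subgradient inequalities of f give
     E(u_{k+1}) <= F(s_k) <= E(u_k) - rho1 |u_{k+1} - u_k|^2,
   while F has a subgradient at s_k of norm at most C |u_{k+1} - u_k|.  Every
   limit (u, q) of (s_k) satisfies q \in df(u) and F(u, q) = E(u) = E*, so the KL
   property holds there.  Only u is asserted to have finite length, so the q_k
   may wander among the limit points and one KL neighbourhood is not enough; the
   KL inequality is made uniform along the sequence by compactness.  With
   r_k := F(s_k) - E* and delta_k := |u_{k+1} - u_k| it then gives
     2 delta_{k+1} <= delta_k + C / rho1 (phi(r_k) - phi(r_{k+1})),
   which telescopes. *)
Require Import Defs.
From HB Require Import structures.
From mathcomp Require Import all_boot all_order all_algebra.
From mathcomp Require Import all_classical all_reals all_analysis.
From mathcomp Require Import ring lra.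

Set Implicit Arguments.
Unset Strict Implicit.
Unset Printing Implicit Defensive.

Import Order.TTheory GRing.Theory Num.Theory.
Import numFieldNormedType.Exports.

Local Open Scope classical_set_scope.
Local Open Scope ring_scope.

(** * Euclidean inner product and norm, convergence of row vectors *)

Section EuclideanSpace.
Variables (R : realType) (n : nat).
Implicit Types (u v w : 'rV[R]_n) (a : R).

Lemma dotvC u v : dotv u v = dotv v u.
Proof. by apply: eq_bigr => i _; rewrite mulrC. Qed.

Lemma dotvDl u v w : dotv (u + v) w = dotv u w + dotv v w.
Proof. by rewrite -big_split; apply: eq_bigr => i _; rewrite mxE mulrDl. Qed.

Lemma dotvZl a u v : dotv (a *: u) v = a * dotv u v.
Proof. by rewrite mulr_sumr; apply: eq_bigr => i _; rewrite mxE mulrA. Qed.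

Lemma dotvDr u v w : dotv u (v + w) = dotv u v + dotv u w.
Proof. by rewrite ![dotv u _]dotvC dotvDl. Qed.

Lemma dotvZr a u v : dotv u (a *: v) = a * dotv u v.
Proof. by rewrite ![dotv u _]dotvC dotvZl. Qed.

Lemma dotvNl u v : dotv (- u) v = - dotv u v.
Proof. by rewrite -scaleN1r dotvZl mulN1r. Qed.

Lemma dotvNr u v : dotv u (- v) = - dotv u v.
Proof. by rewrite ![dotv u _]dotvC dotvNl. Qed.

Definition dotvE := (dotvDl, dotvDr, dotvNl, dotvNr, dotvZl, dotvZr).

Lemma dotvv_ge0 u : 0 <= dotv u u.
Proof. by apply: sumr_ge0 => i _; rewrite -expr2 sqr_ge0. Qed.

Lemma enorm_ge0 u : 0 <= enorm u.
Proof. exact: sqrtr_ge0. Qed.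

Lemma enorm_sqr u : enorm u ^+ 2 = dotv u u.
Proof. by rewrite sqr_sqrtr ?dotvv_ge0. Qed.

Lemma enormN u : enorm (- u) = enorm u.
Proof. by rewrite /enorm dotvNl dotvNr opprK. Qed.

Lemma enormZ a u : enorm (a *: u) = `|a| * enorm u.
Proof.
by rewrite /enorm dotvZl dotvZr mulrA -expr2 sqrtrM ?sqr_ge0// sqrtr_sqr.
Qed.

Lemma coord_le_enorm u i : `|u ord0 i| <= enorm u.
Proof.
rewrite -sqrtr_sqr ler_wsqrtr// /dotv (bigD1 i)//= -expr2 lerDl.
by apply: sumr_ge0 => j _; rewrite -expr2 sqr_ge0.
Qed.

Lemma enorm_eq0 u : enorm u = 0 -> u = 0.
Proof.
move=> u0; apply/rowP => i; rewrite mxE; apply/eqP.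
by rewrite -normr_le0 -u0 coord_le_enorm.
Qed.

(** Cauchy-Schwarz: for nonzero vectors, expand the square of |v| u - |u| v, which is nonnegative,
    and divide by |u| |v|. *)
Lemma dotv_le_enorm u v : dotv u v <= enorm u * enorm v.
Proof.
have dotv0 w : dotv 0 w = 0 by rewrite -(scale0r 0) dotvZl mul0r.
have [/enorm_eq0 ->|u0] := eqVneq (enorm u) 0.
  by rewrite dotv0 mulr_ge0 ?enorm_ge0.
have [/enorm_eq0 ->|v0] := eqVneq (enorm v) 0.
  by rewrite dotvC dotv0 mulr_ge0 ?enorm_ge0.
have uv : 0 < enorm u * enorm v.
  by rewrite mulr_gt0// lt_neqAle eq_sym ?u0 ?v0 enorm_ge0.
have := dotvv_ge0 (enorm v *: u - enorm u *: v).
rewrite !dotvE -!enorm_sqr (dotvC v u) => h.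
by rewrite -(ler_pM2l uv); lra.
Qed.

Lemma enormD u v : enorm (u + v) <= enorm u + enorm v.
Proof.
rewrite -(@ler_pXn2r _ 2)// ?nnegrE ?addr_ge0 ?enorm_ge0//.
rewrite enorm_sqr !dotvE (dotvC v u) sqrrD -!enorm_sqr.
by have := dotv_le_enorm u v; lra.
Qed.

Lemma cvg_coord T (F : set_system T) {FF : Filter F} (x : T -> 'rV[R]_n) u i :
  x @ F --> u -> x t ord0 i @[t --> F] --> u ord0 i.
Proof. by move=> xu; exact: (cvg_comp _ _ xu (@coord_continuous _ _ _ _ _ u)). Qed.

Lemma cvg_rowv T (F : set_system T) {FF : Filter F} (x : T -> 'rV[R]_n) u :
  (forall i, x t ord0 i @[t --> F] --> u ord0 i) -> x @ F --> u.
Proof.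
move=> h A [P nP PA]; apply: (@filterS _ F _ [set t | forall i, P ord0 i (x t ord0 i)]).
  by move=> t Pt; apply: PA => i j; rewrite (ord1 i).
by apply: filter_forall => i; exact: h.
Qed.

Lemma cvg_dotv T (F : set_system T) {FF : Filter F} (x y : T -> 'rV[R]_n) u v :
  x @ F --> u -> y @ F --> v -> dotv (x t) (y t) @[t --> F] --> dotv u v.
Proof.
by move=> xu yv; apply: cvg_big => [|i _]; [exact: add_continuous|]; apply: cvgM;
  exact: cvg_coord.
Qed.

Lemma cvg_enorm0 T (F : set_system T) {FF : Filter F} (x : T -> 'rV[R]_n) :
  enorm (x t) @[t --> F] --> (0 : R) -> x @ F --> (0 : 'rV[R]_n).
Proof.
move=> x0; apply: cvg_rowv => i; rewrite mxE; apply: norm_cvg0.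
apply: (squeeze_cvgr _ (cvg_cst (0 : R)) x0).
by near=> t; rewrite normr_ge0 coord_le_enorm.
Unshelve. all: by end_near. Qed.

(** A product of segments, compact by Tychonoff. It provides a compact set containing the Euclidean
    ball of radius [a]. *)
Lemma sup_ball_compact a : compact [set u : 'rV[R]_n | forall i, `|u ord0 i| <= a].
Proof.
have -> : [set u : 'rV[R]_n | forall i, `|u ord0 i| <= a] =
    [set u : 'rV[R]_n | forall i, `[- a, a]%classic (u ord0 i)].
  by apply/seteqP; split => u /= h i; have := h i; rewrite in_itv/= ler_norml.
by apply: (@rV_compact _ _ (fun=> `[- a, a]%classic)) => _; exact: segment_compact.
Qed.

End EuclideanSpace.

Lemma enorm_row_mx (R : realType) (m n : nat) (u : 'rV[R]_m) (v : 'rV[R]_n) :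
  enorm (row_mx u v) <= enorm u + enorm v.
Proof.
rewrite -(@ler_pXn2r _ 2)// ?nnegrE ?addr_ge0 ?enorm_ge0//.
rewrite enorm_sqr sqrrD !enorm_sqr /dotv big_split_ord/=.
under eq_bigr do rewrite row_mxEl.
under [X in _ + X]eq_bigr do rewrite row_mxEr.
have := mulr_ge0 (enorm_ge0 u) (enorm_ge0 v); lra.
Qed.

Lemma cvg_row_mx (R : realType) (m n : nat) T (F : set_system T)
    {FF : Filter F} (x : T -> 'rV[R]_m) (y : T -> 'rV[R]_n)
    (u : 'rV[R]_m) (v : 'rV[R]_n) :
  x @ F --> u -> y @ F --> v -> row_mx (x t) (y t) @[t --> F] --> row_mx u v.
Proof.
move=> xu yv; apply: cvg_rowv => i; rewrite mxE.
under eq_fun do rewrite mxE.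
by case: (fintype.split i) => j; exact: cvg_coord.
Qed.

(** * Derivatives along lines, the descent lemma, slopes of concave functions *)

Lemma is_derive_line (R : realType) (V W : normedModType R) (g : V -> W)
    (a v : V) (s : R) :
  differentiable g (a + s *: v) ->
  is_derive s 1 (fun t : R => g (a + t *: v)) ('D_v g (a + s *: v)).
Proof.
move=> dg.
have eqf : (fun h : R => h^-1 *: (((fun t => g (a + t *: v)) \o shift s) (h *: 1)
      - g (a + s *: v))) =
    (fun h : R => h^-1 *: ((g \o shift (a + s *: v)) (h *: v) - g (a + s *: v))).
  apply/funext => h /=; congr (_ *: (g _ - _)).
  by rewrite [h *: 1]mulr1 scalerDl addrCA.
have dgv : derivable g (a + s *: v) v by exact: diff_derivable.
by split; rewrite /derivable /derive eqf.
Qed.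

Lemma deriveE_gradient (R : realType) (n : nat) (E : 'rV[R]_n -> R)
    (x v : 'rV[R]_n) :
  differentiable E x -> 'D_v E x = dotv (gradient E x) v.
Proof.
move=> dE; rewrite deriveE// [in LHS](row_sum_delta v) linear_sum.
by apply: eq_bigr => i _; rewrite linearZ/= mxE deriveE// mulrC.
Qed.

(** The mean value theorem replaces integration: [h] is [E] along the segment minus its quadratic
    upper model, up to a constant, and its derivative at any c >= 0 is at most c L |v|^2 - c L |v|^2
    = 0. *)
Lemma descent_lemma (R : realType) (n : nat) (L : R) (E : 'rV[R]_n -> R) :
  0 <= L -> Psi L E -> forall x y,
  E y <= E x + dotv (gradient E x) (y - x) + L / 2 * enorm (y - x) ^+ 2.
Proof.
move=> L0 [[dE _] lipE _ _] x y; set v := y - x.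
pose g (t : R) := E (x + t *: v).
pose h (t : R) := g t - (t * dotv (gradient E x) v + t ^+ 2 * (L / 2 * enorm v ^+ 2)).
pose dh (t : R) := dotv (gradient E (x + t *: v)) v -
  (dotv (gradient E x) v + (t + t) * (L / 2 * enorm v ^+ 2)).
have dhP (t : R) : is_derive t (1 : R) h (dh t).
  have := is_derive_line (dE (x + t *: v)); rewrite deriveE_gradient// => dg.
  apply: is_derive_eq; rewrite /dh/=.
  by rewrite scaler0 add0r /GRing.scale/= !mulr1; ring.
have [] := @MVT_segment R h dh 0 1 ler01 (fun t _ => dhP t).
  apply: continuous_subspaceT => t.
  by apply: differentiable_continuous; apply/derivable1_diffP; exact: ex_derive.
move=> c; rewrite in_itv/= => /andP[c0 _].
rewrite /h /g /dh !scale1r scale0r addr0 /v subrKC -/v.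
have := dotv_le_enorm (gradient E (x + c *: v) - gradient E x) v.
have := lipE (x + c *: v) x; rewrite addrAC subrr add0r enormZ ger0_norm//.
rewrite dotvDl dotvNl => /(ler_wpM2r (enorm_ge0 v)); nra.
Qed.

(** If the derivative at [s] exceeded the chord slope over [t, s], so would a difference quotient
    taken at some [s - l], against concavity between [t] and [s]. *)
Lemma concave_slope_le (R : realType) (D : set R) (phi : R -> R) (s t : R) :
  convex_function (D : set R^o) (fun s => - phi s) ->
  D s -> D t -> t < s -> derivable phi s 1 ->
  derive1 phi s * (s - t) <= phi s - phi t.
Proof.
move=> cphi Ds Dt ts dphi.
rewrite -ler_pdivlMr ?subr_gt0// leNgt; apply/negP => hlt.
have : h^-1 *: ((phi \o shift s) (h *: 1) - phi s) @[h --> 0^'] --> derive1 phi s.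
  by rewrite derive1E; exact: dphi.
move=> /cvgr_gt /(_ _ hlt) /nbhs_ballP[e /= e0 he].
(* [l < e] makes the estimate of the quotient available; [l <= s - t] makes [s - l] a convex
   combination of [t] and [s]. *)
pose l := Num.min (e / 2) (s - t).
have l0 : 0 < l by rewrite lt_min divr_gt0//= subr_gt0.
have le_e : l < e by rewrite gt_min ltr_pdivrMr// ltr_pMr// ltr1n.
have le_st : l <= s - t by rewrite ge_min lexx orbT.
have := he (- l); rewrite /ball/= sub0r opprK gtr0_norm// oppr_eq0 gt_eqF//.
move=> /(_ le_e isT).
rewrite [_ *: 1]mulr1 invrN.
have st0 : 0 < s - t by rewrite subr_gt0.
have p0 : 0 <= l / (s - t) by apply: divr_ge0; exact: ltW.
have p1 : l / (s - t) <= 1 by rewrite ler_pdivrMr// mul1r.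
have := cphi (Itv01 p0 p1) t s; rewrite !inE => /(_ Dt Ds).
rewrite !convRE /conv/=.
have -> : (l / (s - t)) *: t + unstable.onem (l / (s - t)) *: s = - l + s.
  by rewrite /unstable.onem /GRing.scale/=; field; rewrite gt_eqF.
rewrite /unstable.onem /GRing.scale/= => h1 h2.
have : l * ((phi s - phi t) / (s - t)) < phi s - phi (- l + s).
  rewrite (lt_le_trans (_ : _ < l * (- l^-1 * (phi (- l + s) - phi s))))//.
    by rewrite ltr_pM2l.
  by rewrite mulrA mulrN mulfV ?gt_eqF// mulN1r opprB.
have -> : l * ((phi s - phi t) / (s - t)) = l / (s - t) * (phi s - phi t) by ring.
lra.
Qed.

(** * Subgradients, the resolvent and the conjugate *)

Section ConvexAnalysis.
Variables (R : realType) (n : nat) (f : 'rV[R]_n -> \bar R).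
Hypothesis pf : proper_fun f.
Implicit Types (u v p : 'rV[R]_n).

Lemma subdiff_fin_num u p : subdiff f u p -> f u \is a fin_num.
Proof.
case: pf => fNy [v0 fv0] fup; rewrite fin_numElt fNy/=.
have := le_lt_trans (fup v0) fv0.
by case: (f u) (fNy u) => [r| |]//; rewrite ltry.
Qed.

Lemma subdiff_fine u p v : subdiff f u p -> f v \is a fin_num ->
  fine (f u) + dotv p (v - u) <= fine (f v).
Proof.
move=> fup fv; have fu := subdiff_fin_num fup.
by rewrite -lee_fin EFinD !fineK//; exact: fup.
Qed.

(** The minimiser [u] is compared with u + s (v - u): convexity of [f] and expansion of the square
    give the subgradient inequality up to an error linear in [s]. *)
Lemma resolvent_subdiff (t : R) g u : econvex f -> 0 < t ->
  resolvent t f g u -> subdiff f u (t^-1 *: (g - u)).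
Proof.
move=> cf t0 umin; case: pf => fNy [v0 fv0] v.
have fu : f u \is a fin_num.
  rewrite fin_numElt fNy/=.
  have := umin v0; have := fNy v0; have := fNy u.
  case: (f v0) fv0 => [b| |]//; case: (f u) => [a| |]// _ _ _; rewrite ?ltry//.
  by rewrite gt0_muley ?lte_fin// addey// -EFinM -EFinD leNgt ltry.
have := fNy v; case fvE : (f v) => [b| |]// _; last by rewrite leey.
move: fu; case fuE : (f u) => [a| |]// _.
rewrite -EFinD lee_fin.
have key (s : R) : 0 < s <= 1 ->
    t * (a - b) + dotv (g - u) (v - u) <= s * (2^-1 * enorm (v - u) ^+ 2).
  move=> /andP[s0 s1].
  have s01 : 0 <= s <= 1 by rewrite ltW.
  have := umin (s *: v + (1 - s) *: u).
  have : (t%:E * f (s *: v + (1 - s) *: u)%R <= (t * (s * b + (1 - s) * a))%:E)%E.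
    have := cf v u s s01; rewrite fvE fuE -!EFinM -EFinD => h.
    by rewrite EFinM; apply: lee_wpmul2l h; rewrite lee_fin ltW.
  move=> /(leeD2l (2^-1 * enorm (s *: v + (1 - s) *: u - g) ^+ 2)%:E) h1 h2.
  have := le_trans h2 h1; rewrite fuE -!EFinM -!EFinD lee_fin.
  have -> : s *: v + (1 - s) *: u - g = (u - g) + s *: (v - u).
    by apply/rowP => i; rewrite !mxE; ring.
  have -> : g - u = - (u - g) by rewrite opprB.
  move: (u - g) (v - u) => w d.
  rewrite !enorm_sqr !dotvE (dotvC d w) => h.
  by rewrite -(ler_pM2l s0); lra.
set c := 2^-1 * enorm (v - u) ^+ 2 in key.
have c0 : 0 <= c by rewrite mulr_ge0// sqr_ge0.
suff : t * (a - b) + dotv (g - u) (v - u) <= 0.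
  rewrite dotvZl => h; rewrite -(ler_pM2l t0) mulrDr mulVKf ?gt_eqF//; lra.
set X := _ + _ in key *; rewrite leNgt; apply/negP => X0.
have Xc0 : 0 < X + c by rewrite ltr_wpDr.
(* This [s] lies in (0, 1] and turns [key] into X (X + c) <= X c, impossible for X > 0. *)
have := key (X / (X + c)); rewrite divr_gt0//= ler_pdivrMr// mul1r lerDl c0.
move=> /(_ isT); rewrite mulrAC ler_pdivlMr//.
have := mulr_gt0 X0 X0; nra.
Qed.

(** Equality in Fenchel-Young: the subgradient inequality says that [u] attains the supremum. *)
Lemma conjugate_subdiff u p : subdiff f u p ->
  conjugate f p = (dotv u p - fine (f u))%:E.
Proof.
move=> fup; have fu := subdiff_fin_num fup.
apply/eqP; rewrite eq_le; apply/andP; split; last first.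
  by apply: ereal_sup_ubound; exists u => //; rewrite EFinB fineK.
apply: ge_ereal_sup => _ [v _ <-].
have [fNy _] := pf.
have := fNy v; case fvE : (f v) => [b| |]// _; last by rewrite addeNy leNye.
have fv : f v \is a fin_num by rewrite fvE.
have := subdiff_fine fup fv; rewrite fvE/= -EFinB lee_fin dotvDr dotvNr.
by rewrite (dotvC v p) (dotvC u p); lra.
Qed.

(** The term of [u] in the supremum is affine with slope [u], minorises the conjugate and touches it
    at [p]. *)
Lemma subdiff_conjugate u p : subdiff f u p -> subdiff (conjugate f) p u.
Proof.
move=> fup v; rewrite (conjugate_subdiff fup) -EFinD.
apply: ereal_sup_ubound; exists u => //.
rewrite -[f u]fineK ?(subdiff_fin_num fup)// -EFinB; congr (_%:E).
by rewrite dotvDr dotvNr; ring.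
Qed.

Lemma subdiff_closed T (F : set_system T) {FF : ProperFilter F}
    (x y : T -> 'rV[R]_n) u p :
  lower_semicontinuous f -> x @ F --> u -> y @ F --> p ->
  (\forall t \near F, subdiff f (x t) (y t)) -> subdiff f u p.
Proof.
move=> lscf xu yp xy v.
have [fNy _] := pf.
have := fNy v; case fvE : (f v) => [b| |]// _; last by rewrite leey.
have fv : f v \is a fin_num by rewrite fvE.
suff : (f u <= (b - dotv p (v - u))%:E)%E.
  by rewrite EFinB leeBrDr.
(* If [f u] exceeded the bound by more than [e], semicontinuity would keep [f (x t)] above bound
   plus [e]; but the subgradient inequality at [v] majorises [f (x t)] by a quantity tending to the
   bound. *)
apply/lee_addgt0Pr => e e0; rewrite leNgt -EFinD; apply/negP => /lscf[V nV Vf].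
have lim : b - dotv (y t) (v - x t) @[t --> F] --> b - dotv p (v - u).
  apply: cvgB; first exact: cvg_cst.
  by apply: cvg_dotv => //; apply: cvgB => //; exact: cvg_cst.
have near_lt : \forall t \near F, b - dotv (y t) (v - x t) < b - dotv p (v - u) + e.
  by apply: (cvgr_lt _ lim); rewrite ltrDl.
have xV : \forall t \near F, V (x t) by exact: xu nV.
have [t [xyt [Vxt ltt]]] := filter_ex (filterI xy (filterI xV near_lt)).
have fxt := subdiff_fin_num xyt.
have := subdiff_fine xyt fv; rewrite fvE/= => h1.
have := Vf _ Vxt; rewrite -[f (x t)]fineK// lte_fin; lra.
Qed.

End ConvexAnalysis.

(** * Ultrafilter limits, the KL inequality along a sequence and finite length *)

Lemma ultra_cvg_compact (T : Type) (X : topologicalType) (U : set_system T)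
    (UU : UltraFilter U) (x : T -> X) (K : set X) :
  compact K -> (\forall t \near U, K (x t)) -> exists2 p, K p & x @ U --> p.
Proof.
move=> cK xK; have [p [Kp clp]] := cK (x @ U) _ xK.
exists p => // A nA.
(* A cluster point of an ultrafilter is a limit: otherwise the complement of the preimage of [A]
   belongs to [U], and [A] would meet its own complement. *)
have [//|UnA] := in_ultra_setVsetC (x @^-1` A) UU.
by have [y [/= nAy Ay]] := clp (~` A) A UnA nA.
Qed.

Section KLAlong.
Variable R : realType.
Implicit Types (r d delta : nat -> R) (A B : set nat).

(* The KL inequality for the values r_k of a sequence with subgradient norms at
   most d_k, for large k in A: psi plays the role of phi', and concavity enters
   only through the slope inequality, so that the property is stable under
   finite unions of index sets (add the functions phi). *)
Definition KL_along r d A := exists (eta : R) (phi psi : R -> R) (K : nat),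
  [/\ 0 < eta,
      forall s t, 0 < t -> t <= s -> s < eta -> psi s * (s - t) <= phi s - phi t,
      forall s, 0 < s < eta -> 0 <= phi s,
      forall s, 0 < s < eta -> 0 < psi s
    & forall k, (K <= k)%N -> A k -> 0 < r k < eta -> 1 <= psi (r k) * d k].

Lemma KL_alongS r d A B : A `<=` B -> KL_along r d B -> KL_along r d A.
Proof.
move=> AB [eta [phi [psi [K [eta0 slope phi0 psi0 h]]]]].
by exists eta, phi, psi, K; split=> // k Kk /AB; exact: h.
Qed.

(** Beyond some index [A] is empty and the inequality is void, so the identity with slope 1
    serves. *)
Lemma KL_along_near r d A : \oo (~` A) -> KL_along r d A.
Proof.
move=> [K _ hK]; exists 1, (fun s => s), (fun=> 1), K; split=> //.
- by move=> s t _ _ _; rewrite mul1r.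
- by move=> s /andP[/ltW].
- by move=> k /hK.
Qed.

Lemma KL_alongU r d A B : (forall k, 0 <= d k) ->
  KL_along r d A -> KL_along r d B -> KL_along r d (A `|` B).
Proof.
move=> d0 [e1 [f1 [g1 [K1 [e10 s1 f10 g10 h1]]]]].
move=> [e2 [f2 [g2 [K2 [e20 s2 f20 g20 h2]]]]].
exists (Num.min e1 e2), (fun s => f1 s + f2 s), (fun s => g1 s + g2 s), (maxn K1 K2).
split.
- by rewrite lt_min e10.
- move=> s t t0 ts; rewrite lt_min => /andP[se1 se2].
  by have := s1 s t t0 ts se1; have := s2 s t t0 ts se2; lra.
- move=> s /andP[s0]; rewrite lt_min => /andP[se1 se2].
  by rewrite addr_ge0 ?f10 ?f20 ?s0.
- move=> s /andP[s0]; rewrite lt_min => /andP[se1 se2].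
  by rewrite addr_gt0 ?g10 ?g20 ?s0.
- move=> k; rewrite geq_max => /andP[K1k K2k] ABk /andP[r0].
  rewrite lt_min => /andP[re1 re2].
  (* The summand belonging to the other index set only helps, being nonnegative. *)
  have g1d : 0 <= g1 (r k) * d k by rewrite mulr_ge0// ltW// g10// r0.
  have g2d : 0 <= g2 (r k) * d k by rewrite mulr_ge0// ltW// g20// r0.
  case: ABk => [Ak|Bk]; rewrite mulrDl.
    by have := h1 k K1k Ak; rewrite r0 re1 => /(_ isT); lra.
  by have := h2 k K2k Bk; rewrite r0 re2 => /(_ isT); lra.
Qed.

(* If the conclusion failed, the sets A such that KL_along r d (~` A) would form
   a proper filter finer than \oo; an ultrafilter above it is excluded by the
   hypothesis.  This replaces extracting a finite cover. *)
Lemma KL_along_ultra r d : (forall k, 0 <= d k) ->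
  (forall U : set_system nat, UltraFilter U -> \oo `<=` U ->
    exists2 A, U A & KL_along r d A) ->
  KL_along r d setT.
Proof.
move=> d0 h; apply: contrapT => nT.
pose F : set_system nat := [set A | KL_along r d (~` A)].
have PF : ProperFilter F.
  split; first by rewrite /F/= setC0.
  split.
  - by rewrite /F/= setCT; apply: (@KL_along_near r d); rewrite setC0; exact: filterT.
  - by move=> A B FA FB; rewrite /F/= setCI; exact: KL_alongU.
  - by move=> A B AB; apply: KL_alongS; exact: subsetC.
have [U [UU FU]] := ultraFilterLemma PF.
have [|A UA KA] := h U UU.
  by move=> A nA; apply: FU; apply: (@KL_along_near r d); rewrite setCK.
have UnA : U (~` A) by apply: FU; rewrite /F/= setCK.
by have [x []] := filter_ex (filterI UA UnA).
Qed.

(** It suffices to bound [delta k.+1] by the decrease of some nonnegative [V] from an index on. If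
    some [r k] vanishes, [delta] is eventually 0 and V = 0 works; otherwise V is delta + (C / rho)
    phi(r). *)
Lemma finite_length r delta (rho C : R) : 0 < rho -> 0 < C ->
  (forall k, 0 <= delta k) -> (forall k, 0 <= r k) ->
  r @ \oo --> (0 : R) ->
  (forall k, r k.+1 + rho * delta k.+1 ^+ 2 <= r k) ->
  KL_along r (fun k => C * delta k) setT ->
  exists M, forall N, \sum_(0 <= k < N) delta k <= M.
Proof.
move=> rho0 C0 delta0 r0 rcvg decr [eta [phi [psi [K [eta0 slope phi0 psi0 KL]]]]].
suff [K' [V [V0 hV]]] : exists K' (V : nat -> R), (forall k, 0 <= V k) /\
    forall k, (K' <= k)%N -> delta k.+1 <= V k - V k.+1.
  exists (\sum_(0 <= k < K'.+1) delta k + V K') => N.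
  have key m : \sum_(0 <= k < K'.+1 + m) delta k + V (K' + m)%N <=
      \sum_(0 <= k < K'.+1) delta k + V K'.
    elim: m => [|m ih]; first by rewrite !addn0.
    apply: le_trans ih; rewrite !addnS big_nat_recr//= -addrA lerD2l addSn.
    by have := hV (K' + m)%N (leq_addr _ _); lra.
  apply: le_trans (key N); rewrite -[leLHS]addr0 lerD//.
  rewrite (@big_cat_nat _ _ _ N 0 (K'.+1 + N))//= ?leq_addl// lerDl.
  exact: sumr_ge0.
have rdecr k : r k.+1 <= r k.
  by apply: le_trans (decr k); rewrite lerDl mulr_ge0 ?sqr_ge0// ltW.
have [[k0 rk0]|rn0] := pselect (exists k, r k = 0).
  have rk k : (k0 <= k)%N -> r k = 0.
    elim: k => [|k ih]; first by rewrite leqn0 => /eqP <-.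
    rewrite leq_eqVlt => /orP[/eqP <-//|/ih rk].
    by apply/le_anti; rewrite r0 andbT -rk.
  exists k0, (fun=> 0); split=> // k kk0; rewrite subr0.
  have := decr k; rewrite !rk ?(leqW kk0)// add0r => h.
  rewrite -(@ler_pXn2r _ 2)// ?nnegrE// expr0n/=.
  by rewrite -(ler_pM2l rho0) mulr0.
have rp k : 0 < r k.
  by rewrite lt_neqAle r0 andbT eq_sym; apply/eqP => rk; apply: rn0; exists k.
have [N1 _ hN1] : \forall k \near \oo, r k < eta by exact: (cvgr_lt _ rcvg).
have Crho0 : 0 <= C / rho by apply: divr_ge0; exact: ltW.
(* [phi] is known to be nonnegative only on (0, eta), hence the default 0; from [N1] on the first
   branch applies at [k] and [k.+1]. *)
exists (maxn K N1), (fun k => if r k < eta then delta k + C / rho * phi (r k) else 0).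
split=> [k|k].
  case: ifPn => // rke; rewrite addr_ge0// mulr_ge0//; by rewrite phi0// rp.
rewrite geq_max => /andP[Kk N1k].
have rke := hN1 k N1k; have rk1e := hN1 k.+1 (leqW N1k).
rewrite rke rk1e.
have kl : 1 <= psi (r k) * (C * delta k) by apply: KL => //; rewrite rp.
have sl := slope (r k) (r k.+1) (rp _) (rdecr k) rke.
set X := C / rho * (phi (r k) - phi (r k.+1)).
have drop : 0 <= r k - r k.+1 by rewrite subr_ge0.
have Cd : 0 <= C * delta k by rewrite mulr_ge0// ltW.
have X0 : 0 <= X.
  by rewrite mulr_ge0// (le_trans _ sl)// mulr_ge0// ltW// psi0// rp.
(* Chain: rho delta_{k+1}^2 <= r_k - r_{k+1} <= psi(r_k) C delta_k (r_k - r_{k+1}) <= C delta_k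
   (phi(r_k) - phi(r_{k+1})). *)
have hX : delta k.+1 ^+ 2 <= delta k * X.
  rewrite -(ler_pM2l rho0).
  have -> : rho * (delta k * X) = C * delta k * (phi (r k) - phi (r k.+1)).
    by rewrite /X; field; rewrite gt_eqF.
  have := ler_wpM2l Cd sl; have := ler_wpM2r drop kl; have := decr k; lra.
(* AM-GM on delta_{k+1}^2 <= delta_k X *)
suff : 2 * delta k.+1 <= delta k + X by rewrite /X; lra.
rewrite -(@ler_pXn2r _ 2)// ?nnegrE ?mulr_ge0 ?addr_ge0//.
have := sqr_ge0 (delta k - X); nra.
Qed.

Lemma nneseries_bounded delta (M : R) : (forall k, 0 <= delta k) ->
  (forall N, \sum_(0 <= k < N) delta k <= M) ->
  (\sum_(0 <= k <oo) (delta k)%:E < +oo)%E.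
Proof.
move=> delta0 hM; apply: (@le_lt_trans _ _ M%:E); last exact: ltry.
apply: lime_le; first by apply: is_cvg_nneseries => k _; rewrite lee_fin.
by near=> N; rewrite sumEFin lee_fin.
Unshelve. all: by end_near. Qed.

End KLAlong.

(** The derivative of [phi] serves as psi, and the subgradient [g k] bounds the distance from 0 to
    [dJ (w k)] by [d k]. *)
Lemma KL_at_along (R : realType) (N : nat) (J : 'rV[R]_N -> \bar R)
    (dJ : 'rV[R]_N -> set 'rV[R]_N) (wbar : 'rV[R]_N) (jbar : R)
    (w g : nat -> 'rV[R]_N) (j d : nat -> R) :
  KL_at J dJ wbar -> J wbar = jbar%:E ->
  (forall k, J (w k) = (j k)%:E) -> (forall k, dJ (w k) (g k)) ->
  (forall k, enorm (g k) <= d k) ->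
  exists2 W, nbhs wbar W &
    KL_along (fun k => j k - jbar) d (w @^-1` W).
Proof.
move=> [eta [W [phi [eta0 nW [[phi0 _] conc _ dphi psi0] KL]]]] Jbar Jw dJw gd.
exists W => //.
(* [eta] may be infinite, so it is cut down to a real [e]. *)
have [e e0 ele] : exists2 e : R, 0 < e & (e%:E <= eta)%E.
  case: eta eta0 {phi0 conc dphi psi0 KL} => [e| |]//; first by exists e.
  by exists 1 => //; exact: leey.
have lt_eta s : s < e -> (s%:E < eta)%E.
  by move=> se; rewrite (lt_le_trans _ ele)// lte_fin.
exists e, phi, (derive1 phi), 0%N; split=> //.
- move=> s t t0; rewrite le_eqVlt => /orP[/eqP ->|ts] se; first by rewrite !subrr mulr0.
  have s0 := lt_trans t0 ts.
  apply: (concave_slope_le conc) => //=.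
  + by split; [exact: ltW|exact: lt_eta].
  + by split; [exact: ltW|apply: lt_eta; exact: lt_trans se].
  + by have [] := dphi s s0 (lt_eta _ se).
- by move=> s /andP[s0 se]; apply: phi0; [exact: ltW|exact: lt_eta].
- by move=> s /andP[s0 se]; apply: psi0 => //; exact: lt_eta.
- move=> k _ Wk /andP[r0 re].
  have := KL _ Wk; rewrite Jw Jbar lte_fin -subr_gt0 r0 => /(_ isT).
  have -> : ((j k)%:E < jbar%:E + eta)%E.
    rewrite (@lt_le_trans _ _ (jbar%:E + e%:E)%E) ?leeD2l//.
    by rewrite -EFinD lte_fin -ltrBlDl.
  move=> /(_ isT); rewrite -EFinB/= => h.
  rewrite -lee_fin (le_trans h)// EFinM lee_pmul2l ?lte_fin ?psi0 ?lt_eta//.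
  apply: (@le_trans _ _ (enorm (g k - 0))%:E); last by rewrite subr0 lee_fin.
  by apply: ereal_inf_lbound; exists (g k).
Qed.

(** * Descent and subgradient estimates for the iteration *)

Section BregmanIteration.
Variables (R : realType) (n : nat) (E : 'rV[R]_n -> R) (f : 'rV[R]_n -> \bar R).
Hypotheses (pf : proper_fun f) (cf : econvex f).

(** By equality in Fenchel-Young the surrogate is [E x] plus the Bregman distance of [f] from [u] to
    [x]. *)
Lemma surrogate_subdiffE (x u p : 'rV[R]_n) : subdiff f u p ->
  f x \is a fin_num ->
  surrogate E f (row_mx x p) =
    (E x + fine (f x) - fine (f u) - dotv p (x - u))%:E.
Proof.
move=> fup fx; rewrite /surrogate row_mxKl row_mxKr (conjugate_subdiff pf fup).
rewrite -[f x]fineK// -!EFinD; congr (_%:E).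
by rewrite !dotvE (dotvC u) (dotvC x)/=; ring.
Qed.

Lemma subdiff_surrogate_row_mx (x u p z : 'rV[R]_n) :
  subdiff f x z -> subdiff f u p ->
  subdiff_surrogate E f (row_mx x p) (row_mx (gradient E x + z - p) (u - x)).
Proof.
move=> fxz fup; rewrite /subdiff_surrogate row_mxKl row_mxKr.
by exists (z, u) => //; split => //; exact: subdiff_conjugate.
Qed.

Variables (tau : nat -> R) (u q : nat -> 'rV[R]_n).
Hypothesis tau_gt0 : forall k, 0 < tau k.
Hypothesis uq : linearised_bregman E f tau u q.

(** The update of [q] is exactly the subgradient in the optimality condition of the resolvent
    step. *)
Lemma bregman_subdiff k : subdiff f (u k) (q k).
Proof.
have [q0 step] := uq; case: k => // k; have [uk ->] := step k.
have := resolvent_subdiff pf cf (tau_gt0 k) uk; congr (subdiff f _ _).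
apply/rowP => i; rewrite !mxE; field; exact: lt0r_neq0.
Qed.

Lemma bregman_gradient k :
  gradient E (u k) = q k - q k.+1 - (tau k)^-1 *: (u k.+1 - u k).
Proof.
have [_ ->] := uq.2 k.
apply/rowP => i; rewrite !mxE; field; exact: lt0r_neq0.
Qed.

(* The value of the surrogate at (u_{k+1}, q_k), as a real number. *)
Definition bregman_surrogate k := E (u k.+1) + fine (f (u k.+1)) - fine (f (u k))
  - dotv (q k) (u k.+1 - u k).

Lemma bregman_fin_num k : f (u k) \is a fin_num.
Proof. exact: subdiff_fin_num (bregman_subdiff k). Qed.

Lemma bregman_surrogate_ge k : E (u k.+1) <= bregman_surrogate k.
Proof.
have := subdiff_fine pf (bregman_subdiff k) (bregman_fin_num k.+1).
by rewrite /bregman_surrogate; lra.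
Qed.

(** Add the descent lemma and the subgradient inequality at u_{k+1} tested at u_k. The terms in [q]
    cancel, leaving (L / 2 - 1 / tau_k) |u_{k+1} - u_k|^2, at most -rho times the square by the
    stepsize bound. *)
Lemma bregman_surrogate_decrease (L rho : R) k : 0 <= L -> Psi L E -> 0 < rho ->
  tau k <= 2 / (L + 2 * rho) ->
  bregman_surrogate k + rho * enorm (u k.+1 - u k) ^+ 2 <= E (u k).
Proof.
move=> L0 EPsi rho0; rewrite ler_pdivlMr => [tauk|]; last by lra.
have Lrho : L / 2 + rho <= (tau k)^-1.
  by rewrite -[leRHS]mul1r ler_pdivlMr//; lra.
have := ler_wpM2r (sqr_ge0 (enorm (u k.+1 - u k))) Lrho.
have := descent_lemma L0 EPsi (u k) (u k.+1); rewrite bregman_gradient.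
have := subdiff_fine pf (bregman_subdiff k.+1) (bregman_fin_num k).
rewrite -(opprB (u k.+1)) /bregman_surrogate.
move: (u k.+1 - u k) => v; rewrite !dotvE -enorm_sqr; lra.
Qed.

(** The update turns the first block into a gradient difference minus a scaled step: [L] bounds the
    former, [tmin^-1] the latter, and 1 accounts for the second block. *)
Lemma bregman_subgradient_bound (L tmin : R) k : Psi L E -> 0 < tmin ->
  tmin <= tau k ->
  enorm (row_mx (gradient E (u k.+1) + q k.+1 - q k) (u k - u k.+1)) <=
    (L + tmin^-1 + 1) * enorm (u k.+1 - u k).
Proof.
move=> [_ lipE _ _] tmin0 tmink; apply: (le_trans (enorm_row_mx _ _)).
have -> : gradient E (u k.+1) + q k.+1 - q k =
    (gradient E (u k.+1) - gradient E (u k)) - (tau k)^-1 *: (u k.+1 - u k).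
  by rewrite (bregman_gradient k); apply/rowP => i; rewrite !mxE; ring.
rewrite -(opprB (u k.+1)) enormN [leRHS]mulrDl mul1r lerD2r.
apply: (le_trans (enormD _ _)); rewrite enormN enormZ mulrDl lerD//.
rewrite ler_wpM2r ?enorm_ge0// gtr0_norm ?invr_gt0//.
by rewrite lef_pV2 ?posrE.
Qed.

End BregmanIteration.

(** * Convergence of the values, limits along ultrafilters, conclusion *)

Theorem theorem4p9 (R : realType) (n : nat) (L : R) (E : 'rV[R]_n -> R)
    (f : 'rV[R]_n -> \bar R) (rho1 : R) (tau : nat -> R)
    (u q : nat -> 'rV[R]_n) :
  0 <= L ->
  Psi L E ->
  Gamma0 f ->
  locally_bounded_subgradients f ->
  KL_function (surrogate E f) (subdiff_surrogate E f) ->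
  0 < rho1 ->
  (forall k : nat, 0 < tau k <= 2 / (L + 2 * rho1)) ->
  0 < inf (range tau) ->
  linearised_bregman E f tau u q ->
  (\sum_(0 <= k <oo) (enorm (u k.+1 - u k))%:E < +oo)%E.
Proof.
move=> L0 EPsi [pf lscf cf] lbf KLF rho0 tauP tmin0 uq.
have tau_gt0 k : 0 < tau k by case/andP: (tauP k).
have tmin_le k : inf (range tau) <= tau k.
  by apply: ge_inf; [exists 0 => _ [m _ <-]; exact: ltW|exists k].
have sub := bregman_subdiff pf cf tau_gt0 uq.
have ffin := bregman_fin_num pf cf tau_gt0 uq.
pose Fs := bregman_surrogate E f u q.
pose delta k := enorm (u k.+1 - u k).
have delta0 k : 0 <= delta k by exact: enorm_ge0.
have Fs_ge k : E (u k.+1) <= Fs k by exact: (bregman_surrogate_ge pf cf tau_gt0 uq).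
have Fs_decr k : Fs k + rho1 * delta k ^+ 2 <= E (u k).
  have /andP[_ tauk] := tauP k.
  exact: (bregman_surrogate_decrease pf cf tau_gt0 uq L0 EPsi rho0 tauk).
have rd0 k : 0 <= rho1 * delta k ^+ 2 by rewrite mulr_ge0 ?sqr_ge0// ltW.
have E_decr : nonincreasing_seq (E \o u).
  apply/nonincreasing_seqP => k /=; have := Fs_ge k; have := Fs_decr k.
  by have := rd0 k; lra.
have E_lb : has_lbound (range (E \o u)).
  have [_ _ _ [m mE]] := EPsi; exists m => _ [k _ <-]; apply: mE.
  by exists (u k).
pose Es := inf (range (E \o u)).
have E_cvg : E (u k) @[k --> \oo] --> Es := nonincreasing_cvgn E_decr E_lb.
have Es_le k : Es <= E (u k) by apply: ge_inf => //; exists k.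
have E_cvg1 : E (u k.+1) @[k --> \oo] --> Es.
  by have := E_cvg; rewrite -(cvg_shiftS (E \o u)).
pose r k := Fs k - Es.
have r_ge0 k : 0 <= r k by rewrite subr_ge0; exact: le_trans (Es_le _) (Fs_ge k).
have r_cvg : r @ \oo --> (0 : R).
  apply: (@squeeze_cvgr _ _ _ _ (fun=> 0) (fun k => E (u k) - Es)).
  - near=> k; rewrite r_ge0/= lerD2r; have := Fs_decr k; have := rd0 k; lra.
  - exact: cvg_cst.
  - by rewrite -(subrr Es); apply: cvgB => //; exact: cvg_cst.
have delta_cvg : delta @ \oo --> (0 : R).
  apply: (@squeeze_cvgr _ _ _ _ (fun=> 0)
    (fun k => Num.sqrt (rho1^-1 * (E (u k) - E (u k.+1))))).
  - near=> k; rewrite delta0/= -[leLHS]ger0_norm// -sqrtr_sqr ler_wsqrtr//.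
    rewrite -(ler_pM2l rho0) mulVKf ?gt_eqF//.
    by have := Fs_ge k; have := Fs_decr k; lra.
  - exact: cvg_cst.
  - rewrite -[X in _ --> X]sqrtr0 -[X in Num.sqrt X](mulr0 rho1^-1) -(subrr Es).
    apply: continuous_cvg; first exact: sqrt_continuous.
    by apply: cvgM; [exact: cvg_cst|exact: cvgB].
pose w k := row_mx (u k.+1) (q k).
(* Here q_{k+1} is taken as subgradient of [f] at u_{k+1}, and u_k as subgradient of the conjugate
   at q_k. *)
pose g k := row_mx (gradient E (u k.+1) + q k.+1 - q k) (u k - u k.+1).
pose C := L + (inf (range tau))^-1 + 1.
have C0 : 0 < C by rewrite ltr_wpDl// addr_ge0// invr_ge0 ltW.
have Fw k : surrogate E f (w k) = (Fs k)%:E by exact: surrogate_subdiffE.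
have dFw k : subdiff_surrogate E f (w k) (g k) by exact: subdiff_surrogate_row_mx.
have g_le k : enorm (g k) <= C * delta k.
  exact: (bregman_subgradient_bound tau_gt0 uq EPsi).
have [[dE _] _ Ebd _] := EPsi.
have Ec : continuous E by move=> x; exact: differentiable_continuous.
pose K := [set x | E x <= E (u 0%N)].
have Kc : compact K.
  apply: bounded_closed_compact; first exact: Ebd.
  by apply: preimage_closed (@closed_le _ _) => x _; exact: Ec.
have uK k : K (u k) by exact: (E_decr 0%N k).
(* All iterates lie in the compact sublevel set [K], so one constant bounds every q_k. *)
have [B [_ qB]] := lbf K Kc.
suff KL : KL_along r (fun k => C * delta k) setT.
  have [|M hM] := finite_length rho0 C0 delta0 r_ge0 r_cvg _ KL.
    by move=> k; have := Fs_ge k; have := Fs_decr k.+1; rewrite /r; lra.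
  exact: nneseries_bounded hM.
apply: KL_along_ultra => [k|U UU ooU]; first by rewrite mulr_ge0// ltW.
have [ub _ u_cvg] : exists2 p, K p & u @ U --> p.
  by apply: ultra_cvg_compact => //; near=> k; exact: uK.
have [qb _ q_cvg] : exists2 p, [set p : 'rV[R]_n | forall i, `|p ord0 i| <= B] p &
    q @ U --> p.
  apply: ultra_cvg_compact; first exact: sup_ball_compact.
  near=> k => i; apply: le_trans (coord_le_enorm _ _) _.
  exact: qB (uK k) (sub k).
(* [U] need not be shift invariant; the limit of u_{k+1} comes from that of u_k and delta_k -> 0. *)
have u1_cvg : u k.+1 @[k --> U] --> ub.
  rewrite (_ : (fun k => u k.+1) = (fun k => u k + (u k.+1 - u k))); last first.
    by apply/funext => k; rewrite subrKC.
  rewrite -[ub]addr0; apply: cvgD => //; apply: cvg_enorm0.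
  exact: cvg_trans (cvg_app _ ooU) delta_cvg.
have qub : subdiff f ub qb.
  apply: (subdiff_closed pf lscf u_cvg q_cvg).
  by near=> k; exact: sub.
have Eub : E ub = Es.
  apply: (@cvg_unique _ _ (E (u k) @[k --> U])) => //.
    exact: continuous_cvg (Ec ub) u_cvg.
  exact: cvg_trans (cvg_app _ ooU) E_cvg.
(* The Bregman distance from [ub] to itself vanishes, leaving [E ub]. *)
have Fub : surrogate E f (row_mx ub qb) = Es%:E.
  rewrite (surrogate_subdiffE E pf qub (subdiff_fin_num pf qub)) -Eub.
  by congr (_%:E); rewrite subrr addrK -(scale0r 0) dotvZr mul0r subr0.
have [W nW KLW] : exists2 W, nbhs (row_mx ub qb) W &
    KL_along r (fun k => C * delta k) (w @^-1` W).
  apply: (KL_at_along _ Fub Fw dFw g_le); apply: KLF.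
  by exists (row_mx (gradient E ub + qb - qb) (ub - ub)); exact: subdiff_surrogate_row_mx.
by exists (w @^-1` W) => //; exact: (cvg_row_mx u1_cvg q_cvg).
Unshelve. all: by end_near. Qed.
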